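(* There is a function $\delta:\mathbb{N}\to\mathbb{R}_{\geq0}$ with $\delta(n)\to 0$ as $n\to\infty$ such that for every $n\in\mathbb{N}$ there is a nonzero nonnegative $n\times n$ matrix $M$ satisfying $\operatorname{rank}_{+}M/\operatorname{rank}M\geq n^{1-\delta(n)}$ (i.e. $\operatorname{rank}_{+}M/\operatorname{rank}M=n^{1-o(1)}$).
   Context: The nonnegative rank $\operatorname{rank}_+ M$ of a nonnegative $m\times n$ matrix $M$ is the minimum $r$ such that $M=TU$ with $T\in\mathbb{R}_{\geq0}^{m\times r}$ and $U\in\mathbb{R}_{\geq0}^{r\times n}$; $\operatorname{rank}M$ denotes the ordinary rank. *)

(* Defs.v *)
From mathcomp Require Import all_boot all_order all_algebra.
From mathcomp Require Import boolp.

Set Implicit Arguments.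
Unset Strict Implicit.
Unset Printing Implicit Defensive.

Import Order.TTheory GRing.Theory Num.Theory.

Local Open Scope ring_scope.

Definition nonneg_factorization (R : numFieldType) (m n : nat)
    (M : 'M[R]_(m, n)) (r : nat) : Prop :=
  exists (T : 'M[R]_(m, r)) (U : 'M[R]_(r, n)),
    [/\ T \is a mxOver Num.nneg, U \is a mxOver Num.nneg & M = T *m U].

Lemma ex_nonneg_factorization (R : numFieldType) (m n : nat)
    (M : 'M[R]_(m, n)) (M_ge0 : M \is a mxOver Num.nneg) :
  exists r, `[< nonneg_factorization M r >].
Proof.
exists n; apply/asboolP; exists M, 1%:M; split=> //; last by rewrite mulmx1.
by apply/mxOverP=> i j; rewrite mxE nnegrE ler0n.
Qed.

(* A matrix with a negative entry has no nonnegative factorization, hence the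
   nonnegativity proof as an argument. *)
Definition nonneg_rank (R : numFieldType) (m n : nat)
    (M : 'M[R]_(m, n)) (M_ge0 : M \is a mxOver Num.nneg) : nat :=
  ex_minn (ex_nonneg_factorization M_ge0).

(* Main.v *)
(* Let [E] be a relation on a set [V] of size [N] with at least half of all
   pairs but no full rectangle with both sides of size about [2 log N] (it
   exists by counting). On [V ^ k], the matrix [M x y = (1 - f x y)^2], where
   [f x y] is the number of coordinates at which [E] fails, has rank at most
   [(1 + k N)^2]. A nonnegative factorization covers the pairs with [f = 0] by
   rectangles avoiding the pairs with [f = 1]. As in the Kaibel-Weltge proof for
   unique disjointness, an induction on [k] shows that such a rectangle contains
   at most [O(N log N)^k] of the [(N^2 / 2)^k] pairs with [f = 0]. Taking
   [N = 2 ^ (h ^ 2)] and [k = h], and padding with zeros, the ratio of the ranks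
   is at least [2 ^ (h ^ 3 - O(h ^ 2))] for a matrix of size [2 ^ (h ^ 3)]. *)
Require Import Defs.
From mathcomp Require Import all_boot all_order all_algebra.
From mathcomp Require Import all_classical all_reals all_analysis.
From mathcomp Require Import zify ring.

Set Implicit Arguments.
Unset Strict Implicit.
Unset Printing Implicit Defensive.

Import Order.TTheory GRing.Theory Num.Theory.
Import numFieldNormedType.Exports.

(** * Counting: a dense relation without large full rectangles *)

Lemma card_supersets (U : finType) (X : {set U}) :
  #|[set E : {set U} | X \subset E]| * 2 ^ #|X| = 2 ^ #|U|.
Proof.
have <- : [set ~: E | E in powerset (~: X)] = [set E : {set U} | X \subset E].
  apply/setP=> E; rewrite inE; apply/imsetP/idP=> [[F]|XE].
    by rewrite powersetE finset.subsetC => XF ->.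
  by exists (~: E); rewrite ?finset.setCK // powersetE finset.setCS.
rewrite card_imset; last exact: finset.setC_inj.
by rewrite card_powerset -expnD [X in 2 ^ X]addnC cardsC.
Qed.

Lemma bin_le_exp n m : 'C(n, m) <= n ^ m.
Proof.
apply: leq_trans (leq_pmulr _ (fact_gt0 m)) _; rewrite bin_ffact.
by elim: m => // m IH; rewrite ffactnSr expnSr; apply: leq_mul; rewrite ?leq_subr.
Qed.

(** Union bound with [s = 2 d + 2]. There are at most [2 ^ (2 d s)] pairs of [s]-sets, and each
    spans a rectangle inside [W] or inside its complement for a fraction at most [2 ^ (1 - s ^ 2)]
    of all [W]. Hence some [W] has no such rectangle on either side, and the larger of [W] and
    [~: W] serves as [E]. *)
Lemma ramsey_relation (V : finType) (d : nat) (cardV : #|V| = 2 ^ d) :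
  exists E : rel V,
    #|V| ^ 2 <= 2 * #|[set u : V * V | E u.1 u.2]| /\
    forall S T : {set V}, {in S & T, forall s t, E s t} ->
      #|S| * #|T| <= (2 * d).+2 * (#|S| + #|T|).
Proof.
set s := (2 * d).+2.
pose full (W : {set V * V}) := [exists P : {set V} * {set V},
   [&& #|P.1| == s, #|P.2| == s & finset.setX P.1 P.2 \subset W]].
have full_small W : ~~ full W -> forall S T : {set V},
    {in S & T, forall x y, (x, y) \in W} ->
    #|S| * #|T| <= s * (#|S| + #|T|).
  move=> nfull S T STW.
  (* A side of size at most [s] gives the bound directly; otherwise both sides shrink to [s]-sets
     and [W] would be full. *)
  have [leS|ltS] := leqP #|S| s; first by nia.
  have [leT|ltT] := leqP #|T| s; first by nia.
  have /card_gt0P[/= S' ] : 0 < #|[set A : {set V} | A \subset S & #|A| == s]|.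
    by rewrite cards_draws bin_gt0 ltnW.
  rewrite !inE => /andP[S'S cS'].
  have /card_gt0P[/= T' ] : 0 < #|[set A : {set V} | A \subset T & #|A| == s]|.
    by rewrite cards_draws bin_gt0 ltnW.
  rewrite !inE => /andP[T'T cT'].
  case/negP: nfull; apply/existsP; exists (S', T') => /=.
  rewrite cS' cT' /=; apply/fintype.subsetP=> -[x y]; rewrite !inE /= => /andP[xS yT].
  by apply: STW; [apply: (fintype.subsetP S'S) | apply: (fintype.subsetP T'T)].
have [W nf1 nf2] : exists2 W, ~~ full W & ~~ full (~: W).
  suff /existsP[W /andP[]] : [exists W, ~~ full W && ~~ full (~: W)] by exists W.
  apply: contraT; rewrite negb_exists => /forallP all_full.
  pose D := [set P : {set V} * {set V} | (#|P.1| == s) && (#|P.2| == s)].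
  pose G P := [set W : {set V * V} | finset.setX P.1 P.2 \subset W].
  have cover : [set: {set V * V}] \subset
      \bigcup_(P in D) (G P :|: [set ~: W | W in G P]).
    apply/fintype.subsetP=> W _; have := all_full W.
    rewrite negb_and !negbK => /orP[] /existsP[P /and3P[P1 P2 PW]];
      apply/bigcupP; exists P; rewrite ?inE ?P1 ?P2 ?PW //.
    by apply/orP; right; apply/imsetP; exists (~: W); rewrite ?inE ?finset.setCK.
  have cG P : P \in D -> #|G P :|: [set ~: W | W in G P]| * 2 ^ (s ^ 2)
     <= 2 * 2 ^ (#|V| ^ 2).
    rewrite inE => /andP[/eqP c1 /eqP c2].
    have := card_supersets (finset.setX P.1 P.2).
    rewrite cardsX c1 c2 card_prod !mulnn -/(G P) => <-.
    rewrite mulnA leq_pmul2r ?expn_gt0 //.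
    apply: leq_trans (leq_card_setU _ _) _.
    by rewrite card_imset; [rewrite mul2n addnn | exact: finset.setC_inj].
  have cD : #|D| <= (2 ^ (d * s)) ^ 2.
    have -> : D = finset.setX [set A : {set V} | #|A| == s] [set A : {set V} | #|A| == s].
      by apply/setP=> P; rewrite !inE.
    by rewrite cardsX card_draws cardV mulnn leq_exp2r // expnM bin_le_exp.
  have := subset_leq_card cover.
  rewrite -finset.powersetT card_powerset cardsT card_prod mulnn => le1.
  have le2 : 2 ^ (#|V| ^ 2) * 2 ^ (s ^ 2) <= #|D| * (2 * 2 ^ (#|V| ^ 2)).
    apply: (@leq_trans (\sum_(P in D) #|G P :|: [set ~: W | W in G P]| * 2 ^ (s ^ 2))).
      rewrite -big_distrl leq_mul2r (leq_trans le1) ?orbT //.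
      elim/big_rec2: _ => [|P y A _ le]; first by rewrite cards0.
      by apply: leq_trans (leq_card_setU _ _) _; rewrite leq_add2l.
    by rewrite -sum_nat_const; apply: leq_sum.
  (* This is absurd, since [s ^ 2 = 2 d s + 2 s]. *)
  have : 2 ^ (s ^ 2) <= 2 ^ (d * s * 2).+1.
    rewrite -(leq_pmul2l (expn_gt0 2 (#|V| ^ 2))).
    apply: leq_trans le2 _; rewrite (expnS 2 (d * s * 2)) (expnM 2 (d * s) 2).
    rewrite [leqRHS]mulnCA [X in _ <= _ * X]mulnC [leqRHS]mulnCA.
    by rewrite leq_mul2r cD orbT.
  rewrite leq_exp2l // /s; nia.
have cW : #|W| + #|~: W| = #|V| ^ 2 by rewrite cardsC card_prod mulnn.
have [le|lt] := leqP (#|V| ^ 2) (2 * #|W|).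
  exists (fun x y => (x, y) \in W); split; last exact: full_small.
  by have <- : W = [set u | (u.1, u.2) \in W] by apply/setP=> -[x y]; rewrite inE.
exists (fun x y => (x, y) \in ~: W); split; last exact: full_small.
have <- : ~: W = [set u | (u.1, u.2) \in ~: W].
  by apply/setP=> -[x y]; rewrite !inE.
by move: lt cW; move: (#|V| ^ 2) #|W| #|~: W| => a b c; lia.
Qed.

(** * Powers of a relation and rectangles avoiding one failure *)

(** Nested pairs let the first coordinate split off by computation in the inductions on [k]. *)
Fixpoint power (V : finType) (k : nat) : finType :=
  if k is k'.+1 then (V * power V k')%type else unit.

Lemma card_power (V : finType) k : #|power V k| = #|V| ^ k.
Proof. by elim: k => [|k IH]; rewrite ?card_unit //= card_prod IH expnS. Qed.

Fixpoint failures (V : finType) (E : rel V) k : power V k -> power V k -> nat :=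
  if k is k'.+1 return power V k -> power V k -> nat
  then fun x y => ~~ E x.1 y.1 + failures E x.2 y.2
  else fun _ _ => 0.

Lemma sum_power0 (V : finType) (F : power V 0 -> nat) : \sum_x F x = F tt.
Proof. by rewrite (big_pred1 (tt : power V 0)) //; case. Qed.

Lemma sum_power_recl (V : finType) k (F : power V k.+1 -> nat) :
  \sum_x F x = \sum_s \sum_a F (s, a).
Proof.
by rewrite (pair_bigA _ (fun s a => F (s, a))) /=; apply: eq_bigr => -[].
Qed.

Lemma sum_failures_eq0 (V : finType) (E : rel V) k :
  \sum_(x : power V k) \sum_(y : power V k) (failures E x y == 0) =
  #|[set u : V * V | E u.1 u.2]| ^ k.
Proof.
elim: k => [|k IH].
  by rewrite !sum_power0.
rewrite expnS -IH.
have -> : #|[set u : V * V | E u.1 u.2]| = \sum_s \sum_t E s t.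
  rewrite pair_bigA -sum1_card big_mkcond /=.
  by apply: eq_bigr => u _; rewrite inE; case: (E _ _).
rewrite sum_power_recl big_distrl; apply: eq_bigr => s _ /=.
under eq_bigr do rewrite sum_power_recl.
rewrite exchange_big big_distrl; apply: eq_bigr => t _ /=.
rewrite big_distrr; apply: eq_bigr => a _; rewrite big_distrr.
by apply: eq_bigr => b _ /=; case: (E s t); rewrite /= ?mul1n.
Qed.

(* If [failures a b = 0], the coordinates [s], [t] extending [a] into [A] and
   [b] into [B] form a rectangle full for [E], so their number is at most [c]
   times the number of rows plus columns; for a fixed row or column, the pairs
   [(a, b)] so counted lie in a rectangle of smaller dimension again avoiding
   [failures = 1]. *)
Lemma rectangle_bound (V : finType) (E : rel V) (c : nat)
    (Ec : forall S T : {set V}, {in S & T, forall s t, E s t} ->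
      #|S| * #|T| <= c * (#|S| + #|T|)) k (A B : pred (power V k)) :
  (forall x y, A x -> B y -> failures E x y != 1) ->
  \sum_x \sum_y [&& A x, B y & failures E x y == 0] <= (2 * c * #|V|) ^ k.
Proof.
elim: k A B => [|k IH] A B AB.
  by rewrite !sum_power0 leq_b1.
(* Requiring [E s t] makes the removed coordinate contribute no failure, so that avoiding
   [failures = 1] passes to dimension [k]. *)
pose Ac t a := [exists s, E s t && A (s, a)].
pose Bc s b := [exists t, E s t && B (t, b)].
have inner a b : \sum_s \sum_t
    [&& A (s, a), B (t, b) & failures E ((s, a) : power V k.+1) (t, b) == 0]
    <= c * (\sum_s [&& A (s, a), Bc s b & failures E a b == 0] +
            \sum_t [&& Ac t a, B (t, b) & failures E a b == 0]).
  have [ab0|abN] := eqVneq (failures E a b) 0; last first.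
    rewrite big1 // => s _; rewrite big1 // => t _.
    by rewrite /= addn_eq0 (negPf abN) !andbF.
  (* Otherwise the extended pair would have exactly one failure. *)
  have ABE s t : A (s, a) -> B (t, b) -> E s t.
    by move=> As Bt; have /= := AB _ _ As Bt; rewrite ab0 addn0; case: (E s t).
  pose S := [set s | A (s, a)]; pose T := [set t | B (t, b)].
  have -> : \sum_s \sum_t [&& A (s, a), B (t, b) &
      failures E ((s, a) : power V k.+1) (t, b) == 0] = #|S| * #|T|.
    rewrite -!sum1_card [X in X * _]big_mkcond [X in _ * X]big_mkcond /=.
    rewrite big_distrl; apply: eq_bigr => s _; rewrite big_distrr.
    apply: eq_bigr => t _; rewrite /= !inE ab0.
    by have := ABE s t; case: (A _); case: (B _) => //= ->.
  have [->|[s0 As0]] := finset.set_0Vmem S; first by rewrite cards0.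
  have [->|[t0 Bt0]] := finset.set_0Vmem T; first by rewrite cards0 muln0.
  move: As0 Bt0; rewrite !inE => As0 Bt0.
  have -> : \sum_s [&& A (s, a), Bc s b & true] = #|S|.
    rewrite -sum1_card [RHS]big_mkcond /=; apply: eq_bigr => s _; rewrite inE andbT.
    case: ifP => //= As; suff -> : Bc s b by [].
    by apply/existsP; exists t0; rewrite Bt0 ABE.
  have -> : \sum_t [&& Ac t a, B (t, b) & true] = #|T|.
    rewrite -sum1_card [RHS]big_mkcond /=; apply: eq_bigr => t _; rewrite inE andbT.
    case: ifP => [Bt|]; last by rewrite andbF.
    suff -> : Ac t a by []; by apply/existsP; exists s0; rewrite As0 ABE.
  by apply: Ec => s t; rewrite !inE; apply: ABE.
have -> : (2 * c * #|V|) ^ k.+1 =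
    c * (#|V| * (2 * c * #|V|) ^ k + #|V| * (2 * c * #|V|) ^ k).
  by rewrite expnS; ring.
apply: (@leq_trans (\sum_a \sum_b
    c * (\sum_s [&& A (s, a), Bc s b & failures E a b == 0] +
         \sum_t [&& Ac t a, B (t, b) & failures E a b == 0]))).
  rewrite sum_power_recl exchange_big; apply: leq_sum => a _.
  under eq_bigr do rewrite sum_power_recl exchange_big.
  by rewrite exchange_big; apply: leq_sum => b _; apply: inner.
under eq_bigr do rewrite -big_distrr big_split /=.
rewrite -big_distrr big_split leq_mul2l; apply/orP; right; apply: leq_add => /=.
- under eq_bigr do rewrite exchange_big.
  rewrite exchange_big -sum_nat_const; apply: leq_sum => s _.
  apply: (IH (fun a => A (s, a)) (Bc s)) => a b As /existsP[t /andP[Est Bt]].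
  by have := AB _ _ As Bt; rewrite /= Est.
- under eq_bigr do rewrite exchange_big.
  rewrite exchange_big -sum_nat_const; apply: leq_sum => t _.
  apply: (IH (Ac t) (fun b => B (t, b))) => a b /existsP[s /andP[Est As]] Bt.
  by have := AB _ _ As Bt; rewrite /= Est.
Qed.

(** * The parameter [h] as a function of the matrix size *)

(** The range [h < n.+1] loses nothing because [h < 2 ^ (h ^ 3)]. At [n = 0] the maximum is empty,
    with value 0. *)
Definition cbrt_log2 (n : nat) : nat := \max_(h < n.+1 | 2 ^ (h ^ 3) <= n) h.

Lemma exp_cube_gt m : (m < 2 ^ (m ^ 3))%N.
Proof.
apply: leq_trans (ltn_expl m (isT : (1 < 2)%N)) _.
by rewrite leq_exp2l //; case: m => // m; rewrite !expnS; nia.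
Qed.

Lemma cbrt_log2_ge m n : (2 ^ (m ^ 3) <= n)%N -> (m <= cbrt_log2 n)%N.
Proof.
move=> le; have lt : (m < n.+1)%N.
  by rewrite ltnS (leq_trans (ltnW (exp_cube_gt m))).
exact: (leq_bigmax_cond (Ordinal lt)).
Qed.

Lemma cbrt_log2_le n : (0 < n)%N -> (2 ^ (cbrt_log2 n ^ 3) <= n)%N.
Proof.
move=> n0; rewrite /cbrt_log2.
by elim/big_rec: _ => // i m le1 le2; rewrite /maxn; case: ifP.
Qed.

Lemma lt_cbrt_log2 n : (n < 2 ^ ((cbrt_log2 n).+1 ^ 3))%N.
Proof. by rewrite ltnNge; apply/negP => /cbrt_log2_ge; rewrite ltnn. Qed.

Local Open Scope ring_scope.

(** * Upper bounds on the rank *)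

(** Rank at most [r] for a kernel. With a free index type [J], sums and products of kernels use
    disjoint unions and pairs of indices. *)
Definition separable_in (R : pzRingType) (X : Type) (g : X -> X -> R) (r : nat) :=
  exists (J : finType) (p q : X -> J -> R),
    (#|J| <= r)%N /\ forall x y, g x y = \sum_j p x j * q y j.

Lemma separable_const (R : pzRingType) (X : Type) (c : R) :
  separable_in (fun _ _ : X => c) 1.
Proof.
exists unit, (fun _ _ => c), (fun _ _ => 1); split; first by rewrite card_unit.
by move=> x y; rewrite (big_pred1 tt) ?mulr1 //; case.
Qed.

Lemma separable_fin (R : pzRingType) (V : finType) (g : V -> V -> R) :
  separable_in g #|V|.
Proof.
exists V, (fun x j => (x == j)%:R), (fun y j => g j y); split=> // x y.
rewrite (bigD1 x) //= eqxx mul1r big1 ?addr0 // => j.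
by rewrite eq_sym => /negPf ->; rewrite mul0r.
Qed.

Lemma separable_comp (R : pzRingType) (X Y : Type) (f : X -> Y) (g : Y -> Y -> R) r :
  separable_in g r -> separable_in (fun x y => g (f x) (f y)) r.
Proof.
by move=> [J [p [q [Jr gE]]]]; exists J, (p \o f), (q \o f).
Qed.

Lemma separableD (R : pzRingType) (X : Type) (g h : X -> X -> R) r s :
  separable_in g r -> separable_in h s ->
  separable_in (fun x y => g x y + h x y) (r + s).
Proof.
move=> [J [p [q [Jr gE]]]] [K [p' [q' [Ks hE]]]].
exists (J + K)%type, (fun x => sum_rect _ (p x) (p' x)),
  (fun y => sum_rect _ (q y) (q' y)).
by split=> [|x y]; [rewrite card_sum leq_add | rewrite big_sumType gE hE].
Qed.

Lemma separableM (R : comPzRingType) (X : Type) (g h : X -> X -> R) r s :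
  separable_in g r -> separable_in h s ->
  separable_in (fun x y => g x y * h x y) (r * s).
Proof.
move=> [J [p [q [Jr gE]]]] [K [p' [q' [Ks hE]]]].
exists (J * K)%type, (fun x u => p x u.1 * p' x u.2),
  (fun y u => q y u.1 * q' y u.2).
split=> [|x y]; first by rewrite card_prod leq_mul.
rewrite gE hE big_distrlr pair_bigA /=.
by apply: eq_bigr => -[j k] _ /=; rewrite mulrACA.
Qed.

(** The count is a sum of [k] kernels, each depending on a single coordinate in [V]. *)
Lemma separable_failures (R : pzRingType) (V : finType) (E : rel V) k :
  separable_in (fun x y : power V k => (failures E x y)%:R : R) (k * #|V|).
Proof.
elim: k => [|k IH].
  exists void, (fun _ _ => 0), (fun _ _ => 0); split; first by rewrite card_void.
  by move=> x y; rewrite big1.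
have := separableD (separable_comp fst (separable_fin (fun s t => (~~ E s t)%:R : R)))
  (separable_comp snd IH).
move=> [J [p [q [Jr gE]]]]; exists J, p, q; split; first by rewrite mulSn.
by move=> x y; rewrite -gE -natrD.
Qed.

Definition padded_mx (R : pzRingType) (X : Type) (n : nat)
    (e : 'I_n -> option X) (g : X -> X -> R) : 'M[R]_n :=
  \matrix_(i, j) if (e i, e j) is (Some x, Some y) then g x y else 0.

Lemma separable_mxrank (F : fieldType) (X : Type) (n : nat)
    (e : 'I_n -> option X) (g : X -> X -> F) r : separable_in g r ->
  (\rank (padded_mx e g) <= r)%N.
Proof.
move=> [J [p [q [Jr gE]]]]; apply: leq_trans Jr.
pose P : 'M[F]_(n, #|J|) :=
  \matrix_(i, l) if e i is Some x then p x (enum_val l) else 0.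
pose Q : 'M[F]_(#|J|, n) :=
  \matrix_(l, j) if e j is Some y then q y (enum_val l) else 0.
suff -> : padded_mx e g = P *m Q by apply: mulmx_max_rank.
apply/matrixP=> i j; rewrite !mxE.
under eq_bigr do rewrite !mxE.
case: (e i) => [x|]; last by rewrite big1 // => l _; rewrite mul0r.
case: (e j) => [y|]; last by rewrite big1 // => l _; rewrite mulr0.
by rewrite gE (reindex (@enum_val J J)) //; apply: onW_bij; apply: enum_val_bij.
Qed.

(** * Lower bounds on the nonnegative rank *)

Lemma mxrank_le_nonneg_rank (R : numFieldType) m n (M : 'M[R]_(m, n))
    (M_ge0 : M \is a mxOver Num.nneg) : (\rank M <= nonneg_rank M_ge0)%N.
Proof.
rewrite /nonneg_rank; case: ex_minnP => r /asboolP[T [U [_ _ ->]]] _.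
exact: mulmx_max_rank.
Qed.

(* The supports of the rank-one terms of a nonnegative factorization are
   rectangles inside the support of [M], i.e. they avoid [failures = 1], and
   together they cover the pairs with [failures = 0]. *)
Lemma nonneg_factorization_failures (R : numFieldType) (V : finType) (E : rel V)
    (c k n : nat) (e : 'I_n -> option (power V k)) (f : power V k -> 'I_n)
    (fe : forall x, e (f x) = Some x)
    (Ec : forall S T : {set V}, {in S & T, forall s t, E s t} ->
      (#|S| * #|T| <= c * (#|S| + #|T|))%N) r :
  nonneg_factorization (padded_mx e (fun x y => (1 - (failures E x y)%:R) ^+ 2 : R)) r ->
  (#|[set u : V * V | E u.1 u.2]| ^ k <= r * (2 * c * #|V|) ^ k)%N.
Proof.
move=> [T [U [/mxOverP T0 /mxOverP U0 ME]]].
have MfE x y : (1 - (failures E x y)%:R) ^+ 2 = \sum_l T (f x) l * U l (f y).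
  by move/matrixP/(_ (f x) (f y)): ME; rewrite !mxE !fe.
rewrite -sum_failures_eq0.
pose A l (x : power V k) := T (f x) l != 0.
pose B l (y : power V k) := U l (f y) != 0.
have TU0 x y l : 0 <= T (f x) l * U l (f y).
  by rewrite mulr_ge0 // -nnegrE.
apply: (@leq_trans
  (\sum_(l < r) \sum_x \sum_y [&& A l x, B l y & failures E x y == 0%N])).
  rewrite [leqRHS]exchange_big; apply: leq_sum => x _.
  rewrite [leqRHS]exchange_big; apply: leq_sum => y _.
  have [xy0|//] := eqVneq (failures E x y) 0%N.
  have : \sum_l T (f x) l * U l (f y) != 0.
    by rewrite -MfE xy0 subr0 expr1n oner_neq0.
  apply: contraNT; rewrite -leqNgt leqn0 => /eqP/eqP.
  rewrite sum_nat_eq0 => /forallP TU; apply/eqP/big1 => l _.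
  have := TU l; rewrite /= eqb0 andbT negb_and !negbK.
  by case/orP=> /eqP ->; rewrite ?mul0r ?mulr0.
rewrite -[r in leqRHS]card_ord -sum_nat_const; apply: leq_sum => l _.
apply: rectangle_bound => // x y Ax By; apply/eqP => xy1.
(* One failure makes the entry zero, so each of its nonnegative summands vanishes, against [Ax] and
   [By]. *)
have /eqP := MfE x y; rewrite xy1 subrr expr0n eq_sym psumr_eq0 //.
by move/allP/(_ l (mem_index_enum _)); rewrite mulf_eq0 (negPf Ax) (negPf By).
Qed.

(** * Choice of parameters and the final estimate *)

Lemma separation (R : numFieldType) (h n : nat) : (2 ^ (h ^ 3) <= n)%N ->
  exists (M : 'M[R]_n) (M_ge0 : M \is a mxOver Num.nneg),
    [/\ M != 0, (\rank M <= 2 ^ (2 * h ^ 2 + 2 * h))%N &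
      (2 ^ (h ^ 3) <= nonneg_rank M_ge0 * 2 ^ (2 * h ^ 2 + 3 * h))%N].
Proof.
move=> len; set d := (h ^ 2)%N.
pose V : finType := 'I_(2 ^ d).
have cV : #|V| = (2 ^ d)%N by rewrite card_ord.
have [E [dense thin]] := ramsey_relation cV.
pose X := power V h.
have cX : #|X| = (2 ^ (h ^ 3))%N by rewrite card_power cV -expnM -expnSr.
have leXn : (#|X| <= n)%N by rewrite cX.
pose e (i : 'I_n) : option X :=
  omap (fun l : 'I_#|X| => enum_val l) (insub (val i)).
pose f (x : X) : 'I_n := widen_ord leXn (enum_rank x).
have fe x : e (f x) = Some x by rewrite /e /f /= valK /= enum_rankK.
pose g (x y : X) : R := (1 - (failures E x y)%:R) ^+ 2.
have sep_g : separable_in g ((1 + h * 2 ^ d) ^ 2).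
  have := separableD (separable_const X (1 : R))
    (separableM (separable_const X (-1 : R)) (separable_failures R E h)).
  move=> s1; have := separableM s1 s1; rewrite mul1n cV mulnn.
  move=> [J [p [q [Jr gE]]]]; exists J, p, q; split=> // x y.
  by rewrite -gE mulN1r -expr2.
have M_ge0 : padded_mx e g \is a mxOver Num.nneg.
  apply/mxOverP=> i j; rewrite mxE nnegrE.
  case: (e i) => // x; case: (e j) => // y.
  by rewrite /g real_exprn_even_ge0 // rpredB ?realn ?real1.
exists (padded_mx e g), M_ge0; split.
- have : (0 < \sum_(x : X) \sum_(y : X) (failures E x y == 0%N))%N.
    rewrite sum_failures_eq0 expn_gt0; apply/orP; left.
    rewrite -(ltn_pmul2l (isT : (0 < 2)%N)) muln0; apply: leq_trans dense.
    by rewrite cV !expn_gt0.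
  rewrite lt0n sum_nat_eq0 negb_forall => /existsP[x /=].
  rewrite sum_nat_eq0 negb_forall => /existsP[y /=].
  rewrite eqb0 negbK => /eqP xy0; apply/eqP => /matrixP/(_ (f x) (f y)).
  rewrite !mxE !fe /g xy0 subr0 expr1n => /eqP; by rewrite oner_eq0.
- apply: leq_trans (separable_mxrank e sep_g) _.
  have -> : (2 * h ^ 2 + 2 * h = (d + h) * 2)%N by rewrite /d; lia.
  rewrite expnM leq_exp2r // expnD mulnC.
  have := ltn_expl h (isT : (1 < 2)%N); have := expn_gt0 2 d; nia.
rewrite /nonneg_rank; case: ex_minnP => r /asboolP fact_r _.
have cover := nonneg_factorization_failures fe thin fact_r.
have N_gt0 : (0 < 2 ^ d)%N by rewrite expn_gt0.
(* The [h]-th power of the density bound meets [cover]. Cancelling [(2 ^ d) ^ h] leaves the loss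
   [(8 (h ^ 2 + 1)) ^ h], which is at most [(2 ^ (2 h + 3)) ^ h] because [h < 2 ^ h]. *)
have : ((2 ^ d) ^ h * ((2 ^ d) ^ h) <= r * (4 * (2 * d).+2) ^ h * (2 ^ d) ^ h)%N.
  rewrite -[X in (X <= _)%N]expnMn mulnn.
  apply: (@leq_trans ((2 * #|[set u : V * V | E u.1 u.2]|) ^ h)).
    rewrite cV in dense; by case: (posnP h) => [->|h0] //; rewrite leq_exp2r.
  rewrite expnMn; apply: leq_trans (leq_mul (leqnn (2 ^ h)) cover) _.
  rewrite cV mulnCA -[leqRHS]mulnA -!expnMn leq_mul2l; apply/orP; right.
  by apply: eq_leq; congr (_ ^ _)%N; ring.
rewrite leq_pmul2r ?expn_gt0 ?N_gt0 // -expnM -expnSr => /leq_trans; apply.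
rewrite leq_mul2l; apply/orP; right.
have -> : (2 * h ^ 2 + 3 * h = (2 * h + 3) * h)%N by lia.
rewrite expnM; case: (posnP h) => [-> //|h0]; rewrite leq_exp2r //.
rewrite expnD expnM.
have := ltn_expl h (isT : (1 < 2)%N).
have -> : ((2 ^ 2) ^ h = 2 ^ h * 2 ^ h)%N by rewrite -expnMn.
by rewrite /d; move: (2 ^ h)%N => t; nia.
Qed.

Local Open Scope classical_set_scope.

Theorem theorem3p1 (R : realType) :
  exists delta : nat -> R,
    [/\ forall n : nat, 0 <= delta n,
        delta n @[n --> \oo] --> (0 : R)
      & forall n : nat, (0 < n)%N ->
          exists (M : 'M[R]_n) (M_ge0 : M \is a mxOver Num.nneg),
            M != 0 /\
            n%:R `^ (1 - delta n) <= (nonneg_rank M_ge0)%:R / (\rank M)%:R].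
Proof.
(* As [n < 2 ^ ((h + 1) ^ 3)], the constant 7 bounds the target by 2 to the power [(h + 1) ^ 2 (h -
   6) = h ^ 3 - 4 h ^ 2 - 11 h - 6], below the exponent [h ^ 3 - 4 h ^ 2 - 5 h] that [separation]
   provides. *)
exists (fun n => 7 / (cbrt_log2 n).+1%:R); split.
- by move=> n; rewrite divr_ge0.
- apply/cvgrPdist_le => eps eps0; near=> n.
  rewrite sub0r normrN ger0_norm ?divr_ge0 // ler_pdivrMr // mulrC -ler_pdivrMr //.
  apply: le_trans (ltW (archi_boundP _)) _; first by rewrite divr_ge0 // ltW.
  rewrite ler_nat; apply: leqW; apply: cbrt_log2_ge.
  near: n; exact: nbhs_infty_ge.
move=> n n0; set h := cbrt_log2 n.
have [M [M0 [nzM rkM nrkM]]] := separation R (cbrt_log2_le n0).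
exists M, M0; split=> //.
have rk0 : (0 < \rank M)%N by rewrite lt0n mxrank_eq0.
rewrite ler_pdivlMr ?ltr0n //.
(* For [h <= 5] the exponent is negative, so a ratio of at least 1 suffices; from [h = 6] on it is
   nonnegative and the power is monotone in its base. *)
have [h6|h6] := leqP h 5.
  apply: (@le_trans _ _ (\rank M)%:R); last by rewrite ler_nat mxrank_le_nonneg_rank.
  rewrite ger_pMl ?ltr0n // -[leRHS](powRr0 n%:R).
  apply: ler_powR; first by rewrite ler1n.
  rewrite subr_le0 ler_pdivlMr // mul1r ler_nat; lia.
have powE : (2 ^ (h.+1 ^ 3))%:R `^ (1 - 7 / h.+1%:R) =
    (2 ^ (h.+1 ^ 2 * (h - 6)))%:R :> R.
  rewrite !natrX -!powR_mulrn // -powRrM; congr (_ `^ _).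
  have h10 : h.+1%:R != 0 :> R by rewrite pnatr_eq0.
  rewrite natrM natrB // !natrX mulrBr mulr1.
  rewrite -(natr1 h) in h10 *; field.
  done.
apply: (@le_trans _ _ ((2 ^ (h.+1 ^ 2 * (h - 6)))%:R * (\rank M)%:R)).
  rewrite ler_pM2r ?ltr0n // -powE ge0_ler_powR ?nnegrE //.
    by rewrite subr_ge0 ler_pdivrMr // mul1r ler_nat; lia.
  by rewrite ler_nat ltnW // lt_cbrt_log2.
rewrite -natrM ler_nat -(leq_pmul2r (expn_gt0 2 (2 * h ^ 2 + 3 * h))).
apply: leq_trans nrkM.
apply: leq_trans (leq_mul (leq_mul (leqnn _) rkM) (leqnn _)) _.
by rewrite -!expnD leq_exp2l //; nia.
Unshelve. all: by end_near.
Qed.
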